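(* For any measurable $f:\mathbb R^p\times[K]\to\mathbb R$, any joint distribution $\mathbb P$ of $(\boldsymbol X,S,Y)$ and any $\sigma>0$, the randomized predictor $\hat\Pi(f)$ defined in the context satisfies $$\mathrm{Law}\big(\hat\Pi(f)(\boldsymbol X,S)\mid S=s\big)=\mathrm{Law}\big(\hat\Pi(f)(\boldsymbol X,S)\mid S=s'\big)\qquad\forall s,s'\in[K],$$ where the law involves all the randomness in $\hat\Pi(f)(\boldsymbol X,S)$ (the auxiliary samples, the noises and $(\boldsymbol X,S)$).
   Context: Let $(\boldsymbol X,S,Y)\sim\mathbb P$ on $\mathbb R^p\times[K]\times\mathbb R$ with $\mathbb P(S=s)>0$ for all $s$, and fix $\boldsymbol w\in\Delta^{K-1}$. For each $s\in[K]$, let $\boldsymbol X^s_1,\dots,\boldsymbol X^s_{2N_s}$ be i.i.d. from $\mathrm{Law}(\boldsymbol X\mid S=s)$, independent of $(\boldsymbol X,S,Y)$ and of all other variables. Let $\zeta$ and $(\zeta^s_i)_{s\in[K],i\le2N_s}$ be i.i.d. uniform on $[-\sigma,\sigma]$, and $(U^s)_{s\in[K]}$ i.i.d. uniform on $[0,1]$, all mutually independent and independent of everything else. Set $\tilde f^s_i=f(\boldsymbol X^s_i,s)+\zeta^s_i$ and $\tilde f(\boldsymbol x,s)=f(\boldsymbol x,s)+\zeta$. Define for $t\in\mathbb R$: $\hat F_{1,s}(t)=\frac1{N_s+1}\big(\sum_{i=1}^{N_s}\mathbf 1\{\tilde f^s_i<t\}+U^s(1+\sum_{i=1}^{N_s}\mathbf1\{\tilde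 f^s_i=t\})\big)$ and $\hat F_{2,s}(t)=\frac1{N_s}\sum_{i=N_s+1}^{2N_s}\mathbf1\{\tilde f^s_i\le t\}$, with generalized inverse $\hat F_{2,s}^{-1}(u)=\inf\{x:\hat F_{2,s}(x)\ge u\}$. Then $\hat\Pi(f)(\boldsymbol x,s)=\sum_{s'=1}^Kw_{s'}\hat F^{-1}_{2,s'}\circ\hat F_{1,s}\circ\tilde f(\boldsymbol x,s)$. *)

(* Defs.v *)
From HB Require Import structures.
From mathcomp Require Import all_boot all_order all_algebra.
From mathcomp Require Import all_classical all_reals all_analysis.
From Stdlib Require Import List.

Set Implicit Arguments.
Unset Strict Implicit.
Unset Printing Implicit Defensive.

Import Order.TTheory GRing.Theory Num.Theory.
Local Open Scope classical_set_scope.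
Local Open Scope ring_scope.

Section Defs.
Context {R : realType}.

(* Borel sigma-algebra of R^p (represented as row vectors 'rV[R]_p):
   generated by the coordinate maps. *)
Definition Rp_sigma (p : nat) : set (set 'rV[R]_p) :=
  <<s [set A : set 'rV[R]_p | exists (j : 'I_p) (B : set R),
                 measurable B /\ A = [set x : 'rV[R]_p | B (x ord0 j)]] >>.

(* measurability of f : R^p x [K] -> R ([K] carries the discrete sigma-algebra) *)
Definition meas_feature_fun (p K : nat) (f : 'rV[R]_p -> 'I_K -> R) : Prop :=
  forall (s : 'I_K) (B : set R), measurable B ->
    @Rp_sigma p ((fun x => f x s) @^-1` B).

Context {d : measure_display} {T : measurableType d}.

Definition condP (P : probability T R) (A C : set T) : R :=
  fine (P (A `&` C)) / fine (P C).

Definition preimage_sigma (U : Type) (M : set (set U)) (Z : T -> U) : set (set T) :=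
  [set Z @^-1` B | B in M].

Definition mutually_independent (P : probability T R) (I : Type)
    (valid : I -> Prop) (G : I -> set (set T)) : Prop :=
  forall (J : list I) (A : I -> set T),
    NoDup J -> (forall j, In j J -> valid j) ->
    (forall j, In j J -> G j (A j)) ->
    P [set w | forall j, In j J -> A j w] = (\prod_(j <- J) P (A j))%E.

Definition is_uniform (P : probability T R) (Z : T -> R) (a b : R) : Prop :=
  forall B : set R, measurable B ->
    P (Z @^-1` B) = (lebesgue_measure (B `&` `[a, b]) * ((b - a)^-1)%:E)%E.

End Defs.

Inductive rv_index (K : nat) : Type :=
| IMain                          (* the triple (X, S, Y) *)
| IXs    of 'I_K & nat
| IZeta
| IZetas of 'I_K & nat
| IU     of 'I_K.

Definition rv_valid (K : nat) (N : 'I_K -> nat) (j : rv_index K) : Prop :=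
  match j with
  | IXs s i => (i < 2 * N s)%N
  | IZetas s i => (i < 2 * N s)%N
  | _ => True
  end.

Section Construction.
Context {R : realType} {d : measure_display} {T : measurableType d}.
Variables (p K : nat).

Definition rv_sigma (X : T -> 'rV[R]_p) (S : T -> 'I_K) (Y : T -> R)
  (Xs : 'I_K -> nat -> T -> 'rV[R]_p) (zeta : T -> R)
  (zetas : 'I_K -> nat -> T -> R) (U : 'I_K -> T -> R)
  (j : rv_index K) : set (set T) :=
  match j with
  | IMain => <<s [set A | exists B1 B2 B3, @Rp_sigma R p B1 /\ measurable B3 /\
                   A = X @^-1` B1 `&` S @^-1` B2 `&` Y @^-1` B3] >>
  | IXs s i => preimage_sigma (@Rp_sigma R p) (Xs s i)
  | IZeta => preimage_sigma measurable zeta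
  | IZetas s i => preimage_sigma measurable (zetas s i)
  | IU s => preimage_sigma measurable (U s)
  end.

Variables (f : 'rV[R]_p -> 'I_K -> R) (w : 'I_K -> R) (N : 'I_K -> nat)
  (X : T -> 'rV[R]_p) (S : T -> 'I_K)
  (Xs : 'I_K -> nat -> T -> 'rV[R]_p) (zeta : T -> R)
  (zetas : 'I_K -> nat -> T -> R) (U : 'I_K -> T -> R).

(* noisy scores f~^s_i (indices i = 0 .. 2 N_s - 1; the first N_s form the
   first half, the last N_s the second half) *)
Definition ftilde (s : 'I_K) (i : nat) (o : T) : R :=
  f (Xs s i o) s + zetas s i o.

Definition F1hat (s : 'I_K) (t : R) (o : T) : R :=
  ((N s).+1%:R)^-1 *
  ((\sum_(0 <= i < N s) (((ftilde s i o < t)%R)%:R : R)) +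
   U s o * (1 + \sum_(0 <= i < N s) (((ftilde s i o == t)%R)%:R : R))).

Definition F2hat (s : 'I_K) (t : R) (o : T) : R :=
  (N s)%:R^-1 * \sum_(N s <= i < 2 * N s) (((ftilde s i o <= t)%R)%:R : R).

Definition F2hat_inv (s : 'I_K) (u : R) (o : T) : R :=
  inf [set x | u <= F2hat s x o].

Definition Pihat (o : T) : R :=
  \sum_(s' < K) w s' *
     F2hat_inv s' (F1hat (S o) (f (X o) (S o) + zeta o) o) o.

End Construction.

(* Main.v *)
(** Fix a group s. Given S = s, the noisy score of the test point and the scores
    of the first half of the sample of group s are N_s + 1 i.i.d. variables, so
    the randomized rank F1hat of the test score is exactly uniform on [0, 1]: by
    exchangeability its distribution function at v is the average over the
    N_s + 1 points of the probability that the randomized rank of that point is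
    at most v, and for any real numbers, ties included, these conditional
    probabilities given the scores add up to (N_s + 1) v. The rank is moreover independent of the second halves of
    all the samples, and given S = s the predictor is one fixed measurable
    function, the same for every s, of the rank and of these second halves. *)

Require Import Defs.
From HB Require Import structures.
From mathcomp Require Import all_boot all_order all_algebra.
From mathcomp Require Import all_classical all_reals all_analysis.
From mathcomp Require Import perm measurable_realfun ring lra.
From Stdlib Require Import List.
From mathcomp Require Import seq.
Set Implicit Arguments.
Unset Strict Implicit.
Unset Printing Implicit Defensive.
Import Order.TTheory GRing.Theory Num.Theory.
Import numFieldNormedType.Exports.
Local Open Scope classical_set_scope.
Local Open Scope ring_scope.

(** * Finite and sigma-additivity of a probability with values in R *)

Section real_probability.
Context (R : realType) (d : measure_display) (T : measurableType d)
  (P : probability T R).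

Local Notation pr A := (fine (P A)).

Lemma prE (A : set T) : measurable A -> P A = (pr A)%:E.
Proof. by move=> mA; rewrite fineK// fin_num_measure. Qed.

Lemma pr_setT : pr setT = 1.
Proof. by rewrite probability_setT. Qed.

Lemma pr_setD (A B : set T) : measurable A -> measurable B -> B `<=` A ->
  pr (A `\` B) = pr A - pr B.
Proof.
move=> mA mB BA; apply: EFin_inj; rewrite EFinB -!prE//; last exact: measurableD.
rewrite measureD//; last by rewrite -ge0_fin_numE// fin_num_measure.
by rewrite (setIidr BA).
Qed.

Lemma pr_bigcup_cvg (F : nat -> set T) :
  (forall n, measurable (F n)) -> trivIset setT F ->
  (fun n => \sum_(0 <= i < n) pr (F i)) @ \oo --> pr (\bigcup_n F n).
Proof.
move=> mF tF.
have mU : measurable (\bigcup_n F n) by exact: bigcupT_measurable.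
have L : (fun n => \sum_(0 <= i < n) P (F i))%E @ \oo -->
    (pr (\bigcup_n F n))%:E.
  by rewrite -prE//; exact: measure_sigma_additive.
apply: cvg_trans (fine_cvg L); apply: near_eq_cvg.
near=> n; rewrite /=.
under [X in fine X]eq_bigr do rewrite prE//.
by rewrite sumEFin.
Unshelve. all: by end_near. Qed.

(** Measurability of [B] is a conclusion: when the rank event is cut along comparison matrices, only
    the pieces are known to be measurable. *)
Lemma pr_sum_fin (I : finType) (B : set T) (g : T -> I) :
  (forall i, measurable (B `&` g @^-1` [set i])) ->
  measurable B /\ pr B = \sum_i pr (B `&` g @^-1` [set i]).
Proof.
move=> mg.
have E : B = \bigcup_(i in [set` enum I]) (B `&` g @^-1` [set i]).
  apply/seteqP; split => [x Bx|x [i _ []//]]; exists (g x) => //=.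
  by rewrite mem_enum.
have mB : measurable B by rewrite E; exact: fin_bigcup_measurable.
split => //; apply: EFin_inj; rewrite -prE// -sumEFin.
under eq_bigr do rewrite -prE//.
rewrite -big_enum/= (fsbig_seq _ _ (enum_uniq I)) -measure_fin_bigcup//; last first.
  by move=> i j _ _ [x [] [_ <-] [_ <-]].
by rewrite -E.
Qed.

(** Dynkin's theorem: the sets [E] with the three properties form a Dynkin system. [A1] and [A2] are
    conditioning events, and the constants express equality of conditional laws without division.
    Since [g1] and [g2] are not assumed measurable, measurability is carried along. *)
Lemma g_sigma_algebra_pr_eq (X : Type) (G : set (set X)) (g1 g2 : T -> X)
    (A1 A2 : set T) (c1 c2 : R) :
  setI_closed G -> G setT -> measurable A1 -> measurable A2 ->
  (forall E, G E -> [/\ measurable (A1 `&` g1 @^-1` E),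
     measurable (A2 `&` g2 @^-1` E) &
     c1 * pr (A1 `&` g1 @^-1` E) = c2 * pr (A2 `&` g2 @^-1` E)]) ->
  forall E, <<s G >> E -> [/\ measurable (A1 `&` g1 @^-1` E),
     measurable (A2 `&` g2 @^-1` E) &
     c1 * pr (A1 `&` g1 @^-1` E) = c2 * pr (A2 `&` g2 @^-1` E)].
Proof.
move=> GI GT mA1 mA2 H; rewrite -setI_closed_g_dynkin_g_sigma_algebra//.
apply: smallest_sub => //; split; first exact: H.
- move=> E [m1 m2 e].
  have D (A B : set T) : A `&` ~` B = A `\` (A `&` B).
    by rewrite setDE setCI setIUr setICr set0U.
  rewrite -(preimage_setC g1) -(preimage_setC g2) !D.
  split; [exact: measurableD|exact: measurableD|].
  (* Complements require the total masses to balance, which is the hypothesis at [setT]. *)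
  have [_ _] := H _ GT; rewrite !preimage_setT !setIT => eT.
  by rewrite !pr_setD ?mulrBr ?e ?eT//; apply: subIset; left.
- move=> F tF HF; rewrite !preimage_bigcup !setI_bigcupr.
  have m1 n : measurable (A1 `&` g1 @^-1` F n) by case: (HF n).
  have m2 n : measurable (A2 `&` g2 @^-1` F n) by case: (HF n).
  have t1 : trivIset setT (fun n => A1 `&` g1 @^-1` F n).
    move=> i j _ _ [x [] [_ oi] [_ oj]]; apply: (tF i j) => //.
    by exists (g1 x).
  have t2 : trivIset setT (fun n => A2 `&` g2 @^-1` F n).
    move=> i j _ _ [x [] [_ oi] [_ oj]]; apply: (tF i j) => //.
    by exists (g2 x).
  split; [exact: bigcupT_measurable|exact: bigcupT_measurable|].
  have L1 := cvgM (cvg_cst c1) (pr_bigcup_cvg m1 t1).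
  have L2 := cvgM (cvg_cst c2) (pr_bigcup_cvg m2 t2).
  rewrite -(cvg_lim (@Rhausdorff R) (L1 _ _)) -(cvg_lim (@Rhausdorff R) (L2 _ _)).
  congr (lim (_ @ \oo)); apply/funext => n /=.
  by rewrite !mulr_sumr; apply: eq_bigr => i _; case: (HF i).
Qed.

End real_probability.

(** * Independence of blocks of variables *)

(** The pi-system that generates the joint sigma-algebra of the block [J]; the values of [F] outside
    [J] do not matter. *)
Definition cylinders (I : eqType) (T : Type) (G : I -> set (set T)) (J : seq I) :
    set (set T) :=
  [set A | exists2 F : I -> set T, (forall j, j \in J -> G j (F j)) &
                                   A = \bigcap_(j in [set` J]) F j].

Section cylinders.
Context (I : eqType) (T : Type) (G : I -> set (set T)).
Hypotheses (GI : forall j, setI_closed (G j)) (GT : forall j, G j setT).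

Lemma cylinders_setT J : cylinders G J setT.
Proof.
by exists (fun=> setT) => //; apply/seteqP; split.
Qed.

Lemma cylinders_setI_closed J : setI_closed (cylinders G J).
Proof.
move=> _ _ [F GF ->] [F' GF' ->]; exists (fun j => F j `&` F' j).
  by move=> j jJ; apply: GI; [exact: GF|exact: GF'].
by rewrite bigcapI.
Qed.

Lemma cylinders_cat J J' A C : uniq (J ++ J') ->
  cylinders G J A -> cylinders G J' C -> cylinders G (J ++ J') (A `&` C).
Proof.
rewrite cat_uniq => /and3P[_ /hasPn JJ' _] [F GF ->] [F' GF' ->].
exists (fun j => if j \in J then F j else F' j) => [j|].
  by rewrite mem_cat; case: ifPn => [/GF//|_ /= /GF'].
apply/seteqP; split => [x [Fx F'x] j /=|x H].
  by rewrite mem_cat; case: ifPn => [/Fx//|_ /= /F'x].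
split => j /= jJ; first by have := H j; rewrite /= mem_cat jJ; exact.
have := H j; rewrite /= mem_cat jJ orbT ifN//; first exact.
exact: JJ'.
Qed.

Lemma sub_cylinders J j A : j \in J -> G j A -> cylinders G J A.
Proof.
move=> jJ GA; exists (fun k => if k == j then A else setT) => [k _|].
  by case: eqP => [->|].
apply/seteqP; split => [x Ax k _|x /(_ _ jJ)]; first by case: eqP.
by rewrite eqxx.
Qed.

End cylinders.

Section grouping.
Context (R : realType) (d : measure_display) (T : measurableType d)
  (P : probability T R) (I : eqType) (valid : pred I) (G : I -> set (set T)).
Hypotheses (GI : forall j, setI_closed (G j)) (GT : forall j, G j setT).
Hypothesis Gm : forall j A, valid j -> G j A -> measurable A.

Local Notation pr A := (fine (P A)).

Hypothesis indep : forall (J : seq I) (F : I -> set T), uniq J ->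
  (forall j, j \in J -> valid j) -> (forall j, j \in J -> G j (F j)) ->
  pr (\bigcap_(j in [set` J]) F j) = \prod_(j <- J) pr (F j).

Lemma measurable_cylinders J A : (forall j, j \in J -> valid j) ->
  cylinders G J A -> measurable A.
Proof.
move=> vJ [F GF ->]; apply: fin_bigcap_measurable => // j jJ.
by apply: (Gm (vJ _ jJ)); exact: GF.
Qed.

Lemma cylinders_indep J J' A C : uniq (J ++ J') ->
  (forall j, j \in J ++ J' -> valid j) ->
  cylinders G J A -> cylinders G J' C -> pr (A `&` C) = pr A * pr C.
Proof.
move=> uJJ' vJJ'; have := uJJ'; rewrite cat_uniq => /and3P[uJ /hasPn JJ' uJ'].
move=> [F GF ->] [F' GF' ->].
have vJ j : j \in J -> valid j by move=> jJ; apply: vJJ'; rewrite mem_cat jJ.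
have vJ' j : j \in J' -> valid j.
  by move=> jJ; apply: vJJ'; rewrite mem_cat jJ orbT.
rewrite [in RHS]indep// [in RHS]indep//.
pose H j := if j \in J then F j else F' j.
have JN j : j \in J' -> (j \in J) = false by move=> /JJ'/negbTE.
have -> : \bigcap_(j in [set` J]) F j `&` \bigcap_(j in [set` J']) F' j =
    \bigcap_(j in [set` J ++ J']) H j.
  rewrite /H; apply/seteqP; split => [x [Fx F'x] j /=|x K].
    by rewrite mem_cat; case: ifPn => [/Fx//|_ /= /F'x].
  split => j /= jJ; first by have := K j; rewrite /= mem_cat jJ; exact.
  by have := K j; rewrite /= mem_cat jJ orbT JN//; exact.
rewrite indep//; last first.
  by move=> j; rewrite mem_cat /H; case: ifPn => [/GF//|_ /= /GF'].
rewrite big_cat/=; congr (_ * _); apply: eq_big_seq => j jJ.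
  by rewrite /H jJ.
by rewrite /H JN.
Qed.

(* Each block is passed from its cylinders to the sigma-algebra they generate in
   turn; [C] collects the cylinders of the blocks already treated. *)
Lemma blocks_indep (bs : seq (seq I * set T)) (J : seq I) (C : set T) :
  uniq (flatten [seq b.1 | b <- bs] ++ J) ->
  (forall j, j \in flatten [seq b.1 | b <- bs] ++ J -> valid j) ->
  (forall b, b \in bs -> <<s cylinders G b.1 >> b.2) -> cylinders G J C ->
  measurable (\big[setI/setT]_(b <- bs) b.2) /\
  pr (\big[setI/setT]_(b <- bs) b.2 `&` C) = (\prod_(b <- bs) pr b.2) * pr C.
Proof.
elim: bs J C => [|[J0 A0] bs IH] J C /=.
  by rewrite !big_nil setTI mul1r.
rewrite -catA => u v Hbs HC; rewrite !big_cons/=.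
have {}Hbs0 : <<s cylinders G J0 >> A0 by apply: (Hbs (J0, A0)); rewrite mem_head.
have {Hbs}Hbs b : b \in bs -> <<s cylinders G b.1 >> b.2.
  by move=> bbs; apply: Hbs; rewrite inE bbs orbT.
set L := flatten _ in u v IH; set B := \big[setI/setT]_(b <- bs) b.2.
have vJ0 j : j \in J0 -> valid j by move=> jJ; apply: v; rewrite mem_cat jJ.
have vJ j : j \in J -> valid j.
  by move=> jJ; apply: v; rewrite !mem_cat jJ !orbT.
have /IH : uniq (L ++ J).
  by move: u; rewrite cat_uniq => /and3P[].
move=> /(_ C); case=> //.
  by move=> j jJ; apply: v; rewrite mem_cat jJ orbT.
rewrite -/B => mB BC.
have mC : measurable C by exact: measurable_cylinders HC.
have u' : uniq (L ++ (J ++ J0)) by rewrite catA uniq_catC.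
have v' j : j \in L ++ (J ++ J0) -> valid j.
  by rewrite !mem_cat => h; apply: v; rewrite !mem_cat; case/or3P: h => ->;
    rewrite ?orbT.
have [uL uJJ0] : uniq L /\ uniq (J ++ J0).
  by move: u'; rewrite cat_uniq => /and3P[].
have vJJ0 j : j \in J ++ J0 -> valid j by move=> h; apply: v'; rewrite mem_cat h orbT.
have mD : measurable (B `&` C) by exact: measurableI.
(* The two measures of [E] compared are P(B ∩ C ∩ E) and P(B ∩ C) P(E). For a cylinder [E] over
   [J0], C ∩ E is a cylinder over [J ++ J0], so the induction hypothesis applies to it. *)
have [||||E CE|_ mA0 e] := @g_sigma_algebra_pr_eq _ _ _ P _ (cylinders G J0) id id
    (B `&` C) setT 1 (pr (B `&` C)) _ _ _ _ _ A0 Hbs0.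
- exact: cylinders_setI_closed.
- exact: cylinders_setT.
- exact: mD.
- exact: measurableT.
- have mE : measurable E := measurable_cylinders vJ0 CE.
  rewrite !preimage_id setTI mul1r -setIA; split=> //.
    by apply: measurableI => //; exact: measurableI.
  have [_ ->//] := IH _ (C `&` E) u' v' Hbs (cylinders_cat uJJ0 HC CE).
  by rewrite (cylinders_indep uJJ0)// BC mulrA.
rewrite !preimage_id setTI mul1r in mA0 e; split; first exact: measurableI.
by rewrite -setIA setIC e BC mulrC mulrA.
Qed.

End grouping.

(** * Randomized ranks of finitely many reals *)

Section randomized_rank.
Context (R : realFieldType) (I : finType).
Implicit Types (z : I -> R) (c : R) (A : pred I).

Local Notation clamp c x := (Num.max 0 (Num.min c x)).

(** Both sides are the length of the part of [a, a + m] below [c]. *)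
Lemma clamp_block (c a m : R) : 0 <= a -> 0 < m ->
  m * clamp ((c - a) / m) 1 = clamp c (a + m) - clamp c a.
Proof.
move=> a0 m0.
rewrite maxr_pMr ?ltW// minr_pMr ?ltW// mulr0 mulr1 mulrC divfK ?gt_eqF//.
rewrite /Num.max /Num.min; repeat case: ifPn; rewrite -?leNgt => *; lra.
Qed.

(* With the scores fixed, [c] equal to [n * v] and U uniform on [0, 1], the
   summand is the probability that the randomized rank of [i] among [n] scores
   is at most [v]. The terms of each set of tied points add up to one step of a
   telescoping sum, and the induction removes the largest such set. *)
Lemma sum_randomized_rank z c A :
  (forall i j, A i -> z j <= z i -> A j) ->
  \sum_(i | A i)
      clamp ((c - #|[pred j | z j < z i]|%:R) / #|[pred j | z j == z i]|%:R) 1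
    = clamp c #|A|%:R.
Proof.
have [k] := ubnP #|A|; elim: k A => // k IH A Ak down.
have [/card0_eq A0|] := eqVneq #|A| 0%N.
  rewrite big_pred0// (eq_card0 A0) /Num.max /Num.min.
  by repeat case: ifPn; rewrite -?leNgt => *; lra.
rewrite -lt0n => /card_gt0P[i iA].
(* [i0] has the largest score in [A]. As [A] is downward closed, it consists of the points strictly
   below [i0] and of all points tied with [i0]; the former are the smaller downward closed set of
   the induction. *)
have [i0 i0A max_i0] := Order.TotalTheory.arg_maxP z iA.
pose L := [pred j | z j < z i0]; pose G := [pred j | z j == z i0].
have AL j : A j && (z j < z i0) = L j.
  by rewrite andb_idl// => /ltW; exact: down.
have AG j : A j && ~~ (z j < z i0) = G j.
  rewrite -leNgt; apply/andP/eqP => [[/max_i0 ? ?]|e].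
    by apply/eqP; rewrite eq_le; apply/andP.
  by rewrite e lexx; split => //; apply: down i0A _; rewrite e.
have cA : #|A| = (#|L| + #|G|)%N.
  by rewrite -!sum1_card (bigID (fun j => z j < z i0))/= (eq_bigl _ _ AL) (eq_bigl _ _ AG).
have G0 : (0 < #|G|)%N by apply/card_gt0P; exists i0; rewrite inE.
rewrite (bigID (fun j => z j < z i0))/= (eq_bigl _ _ AL) (eq_bigl _ _ AG) IH; first last.
- by move=> j j' /= /[swap]; exact: le_lt_trans.
- by rewrite -ltnS (leq_trans _ Ak)// ltnS cA -addn1 leq_add2l.
under eq_bigr => j /eqP-> do rewrite -/L -/G.
rewrite sumr_const; have -> : #|(fun j => G j)| = #|G| by [].
rewrite -[X in _ + X]mulr_natl clamp_block ?ltr0n// cA natrD.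
by rewrite addrC subrK.
Qed.

End randomized_rank.

(** * Measurability of generalized inverses *)

(* The set is empty for [u x > 1] and unbounded below for [u x <= 0]; in both
   cases [inf] is [0]. *)
Lemma measurable_generalized_inverse (R : realType) (d : measure_display)
    (T : measurableType d) (F : R -> T -> R) (u : T -> R) :
  (forall q, measurable_fun setT (F q)) -> measurable_fun setT u ->
  (forall x, {homo F ^~ x : q q' / q <= q'}) ->
  (forall q x, 0 <= F q x <= 1) ->
  (forall x, exists q, F q x = 1) ->
  (forall x, exists l, forall q, q < l -> F q x = 0) ->
  measurable_fun setT (fun x => inf [set q | u x <= F q x]).
Proof.
move=> mF mu Fle F01 F1 F0.
apply: (measurability _ (RGenInftyO.measurableE R)) => //.
move=> _ [_ [y ->] <-]; rewrite setTI.
have ninf x : ~~ (0 < u x <= 1) -> inf [set q | u x <= F q x] = 0.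
  rewrite negb_and -leNgt -ltNge => /orP u01; apply: inf_out => -[[q /= uq] [l lq]].
  case: u01 => u01; last first.
    by have /andP[_ +] := F01 q x; rewrite leNgt (lt_le_trans u01).
  have : l <= l - 1.
    by apply: lq; rewrite /= (le_trans u01)//; have /andP[] := F01 (l - 1) x.
  by rewrite lerBrDl gerDr ler10.
have hinf x : 0 < u x <= 1 -> has_inf [set q | u x <= F q x].
  move=> /andP[u0 u1]; split; first by have [q Fq] := F1 x; exists q; rewrite /= Fq.
  have [l Fl] := F0 x; exists l => q /= uq; rewrite leNgt; apply/negP => /Fl e.
  by move: uq; rewrite e leNgt u0.
have m01 : measurable [set x | 0 < u x <= 1].
  rewrite (_ : [set x | _] = u @^-1` [set` `]0, 1]]).
    by rewrite -[X in measurable X]setTI; apply: mu => //; exact: measurable_itv.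
  by apply/seteqP; split => x /=; rewrite in_itv.
(* For levels in ]0, 1], the infimum is below [y] iff the level is reached at some rational below
   [y], by monotonicity of [F]. For other levels the infimum is 0, and only the sign of [y]
   matters. *)
rewrite (_ : _ @^-1` _ = ([set x | 0 < u x <= 1] `&` \bigcup_(q : rat)
    (if ratr q < y then [set x | u x <= F (ratr q) x] else set0)) `|`
  (~` [set x | 0 < u x <= 1] `&` (if 0 < y then setT else set0))).
  apply: measurableU; apply: measurableI => //.
  - apply: bigcupT_measurable_rat => q; case: ifP => // _.
    rewrite (_ : [set x | _] = (fun x => u x <= F (ratr q) x) @^-1` [set true])//.
    rewrite -[X in measurable X]setTI.
    by apply: measurable_fun_ler => //; exact: mF.
  - exact: measurableC.
  - by case: ifP.
apply/seteqP; split => x /=; rewrite in_itv/=.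
  have [ux|ux] := boolP (0 < u x <= 1); last first.
    by rewrite ninf// => ->; right; split => //; exact/negP.
  have [ne _] := hinf _ ux.
  move=> /(inf_lt ne)[z /= uz zy]; left; split => //.
  have [q] := rat_in_itvoo zy; rewrite in_itv/= => /andP[zq qy].
  by exists q => //=; rewrite qy /= (le_trans uz)// Fle// ltW.
case=> [[ux [q _]]|[/negP ux]].
  case: ifP => // qy /= uq; apply: le_lt_trans qy.
  by apply: ge_inf => //; case: (hinf _ ux).
by rewrite ninf//; case: ifP.
Qed.

(** * Comparison matrices *)

(* The randomized rank depends on the scores only through the matrix of their
   strict comparisons, which ranges over a finite type. *)
Section comparison_matrix.
Context (R : realType) (n : nat).
Implicit Types (z : 'I_n -> R) (pi : {ffun 'I_n * 'I_n -> bool}) (t : {perm 'I_n}).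

Definition cmp_mx z : {ffun 'I_n * 'I_n -> bool} := [ffun ij => z ij.1 < z ij.2].

Definition rectangles : set (set ('I_n -> R)) :=
  [set E | exists2 B : 'I_n -> set R, (forall k, measurable (B k)) &
                                      E = [set z | forall k, B k (z k)]].

Lemma rectangles_setI_closed : setI_closed rectangles.
Proof.
move=> _ _ [B mB ->] [B' mB' ->]; exists (fun k => B k `&` B' k).
  by move=> k; exact: measurableI.
by apply/seteqP; split => [z [Bz B'z] k|z h]; split => // k; case: (h k).
Qed.

Lemma rectangles_setT : rectangles setT.
Proof. by exists (fun=> setT) => //; apply/seteqP; split. Qed.

Lemma measurable_coordinate (k : 'I_n) :
  measurable_fun setT (fun z : g_sigma_algebraType rectangles => z k).
Proof.
move=> _ B mB; rewrite setTI; apply: sub_sigma_algebra.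
exists (fun j => if j == k then B else setT) => [j|]; first by case: eqP.
by apply/seteqP; split => [z Bz j|z /(_ k)]; [case: eqP => [->|]|rewrite eqxx].
Qed.

Lemma cmp_mx_event pi : <<s rectangles >> (cmp_mx @^-1` [set pi]).
Proof.
rewrite (_ : _ @^-1` _ = \bigcap_(ij in setT)
    ((fun z : g_sigma_algebraType rectangles => z ij.1 < z ij.2) @^-1` [set pi ij])).
  apply: (@fin_bigcap_measurable _ (g_sigma_algebraType rectangles)) => // ij _.
  rewrite -[X in measurable X]setTI.
  by apply: measurable_fun_ltr => //; exact: measurable_coordinate.
apply/seteqP; split => [z /= <- ij _|z h /=]; first by rewrite /= ffunE.
by apply/ffunP => ij; rewrite ffunE; exact: (h ij).
Qed.

Definition perm_cmp_mx t pi : {ffun 'I_n * 'I_n -> bool} :=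
  [ffun ij => pi (t ij.1, t ij.2)].

Lemma cmp_mx_perm t z : cmp_mx (z \o t) = perm_cmp_mx t (cmp_mx z).
Proof. by apply/ffunP => ij; rewrite !ffunE. Qed.

Lemma perm_cmp_mxK i j : involutive (perm_cmp_mx (tperm i j)).
Proof. by move=> pi; apply/ffunP => -[k l]; rewrite !ffunE /= !tpermK. Qed.

Definition n_below pi i := #|[pred j | pi (j, i)]|.
(** A tie is the absence of both strict comparisons. In a matrix [cmp_mx z] each point is tied with
    itself, so the count is positive. *)
Definition n_tied pi i := #|[pred j | ~~ pi (j, i) && ~~ pi (i, j)]|.

Lemma n_below_perm t pi i : n_below (perm_cmp_mx t pi) i = n_below pi (t i).
Proof.
rewrite /n_below -!sum1_card [RHS](reindex_inj (@perm_inj _ t)) /=.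
by apply: eq_bigl => j; rewrite !inE ffunE.
Qed.

Lemma n_tied_perm t pi i : n_tied (perm_cmp_mx t pi) i = n_tied pi (t i).
Proof.
rewrite /n_tied -!sum1_card [RHS](reindex_inj (@perm_inj _ t)) /=.
by apply: eq_bigl => j; rewrite !inE !ffunE.
Qed.

Lemma n_below_cmp_mx z i : n_below (cmp_mx z) i = #|[pred j | z j < z i]|.
Proof. by apply: eq_card => j; rewrite !inE ffunE. Qed.

Lemma n_tied_cmp_mx z i : n_tied (cmp_mx z) i = #|[pred j | z j == z i]|.
Proof.
by apply: eq_card => j; rewrite !inE !ffunE /= -!leNgt eq_le andbC.
Qed.

Lemma n_tied_gt0 z i : (0 < n_tied (cmp_mx z) i)%N.
Proof. by apply/card_gt0P; exists i; rewrite !inE ffunE /= ltxx. Qed.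

End comparison_matrix.

(** * Independence and law of the scores *)

HB.instance Definition _ (K : nat) := gen_eqMixin (rv_index K).

Lemma uniq_NoDup (I : eqType) (J : seq I) : uniq J -> NoDup J.
Proof.
elim: J => [_|j J IH /= /andP[jJ /IH uJ]]; first exact: NoDup_nil.
apply: NoDup_cons => //; move: jJ; apply: contraNnot.
by elim: J {IH uJ} => //= k J IH [->|/IH]; rewrite inE ?eqxx// => ->; rewrite orbT.
Qed.

Lemma In_mem (I : eqType) (J : seq I) j : In j J <-> j \in J.
Proof.
elim: J => //= k J [IH1 IH2]; rewrite inE; split.
  by case=> [->|/IH1->]; rewrite ?eqxx ?orbT.
by case/predU1P => [->|/IH2]; [left|right].
Qed.

Lemma g_sigma_algebra_setI_closed (T : pointedType) (M : set (set T)) :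
  setI_closed <<s M >>.
Proof. by move=> A B; exact: (@measurableI _ (g_sigma_algebraType M)). Qed.

Lemma g_sigma_algebra_setT (T : pointedType) (M : set (set T)) : <<s M >> setT.
Proof. exact: (@measurableT _ (g_sigma_algebraType M)). Qed.

Lemma preimage_sigma_setI_closed d (T : measurableType d) (V : Type) (M : set (set V)) (Z : T -> V) :
  setI_closed M -> setI_closed (preimage_sigma M Z).
Proof.
move=> MI _ _ [A MA <-] [B MB <-]; exists (A `&` B); first exact: MI.
by rewrite preimage_setI.
Qed.

Section data.
Context (R : realType) (d : measure_display) (Omega : measurableType d)
  (P : probability Omega R) (p K : nat)
  (f : 'rV[R]_p -> 'I_K -> R) (hf : meas_feature_fun f)
  (w : 'I_K -> R) (sigma : R)
  (N : 'I_K -> nat) (hN : forall s, (0 < N s)%N)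
  (X : Omega -> 'rV[R]_p) (S : Omega -> 'I_K) (Y : Omega -> R)
  (hX : forall B, @Rp_sigma R p B -> measurable (X @^-1` B))
  (hS : forall s, measurable (S @^-1` [set s]))
  (hY : measurable_fun setT Y)
  (hSpos : forall s, (0 < P (S @^-1` [set s]))%E)
  (Xs : 'I_K -> nat -> Omega -> 'rV[R]_p)
  (hXs : forall s i B, (i < 2 * N s)%N -> @Rp_sigma R p B ->
          measurable (Xs s i @^-1` B))
  (hXslaw : forall s i B, (i < 2 * N s)%N -> @Rp_sigma R p B ->
          fine (P (Xs s i @^-1` B)) = condP P (X @^-1` B) (S @^-1` [set s]))
  (zeta : Omega -> R) (zetas : 'I_K -> nat -> Omega -> R) (U : 'I_K -> Omega -> R)
  (hzeta : measurable_fun setT zeta)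
  (hzetas : forall s i, (i < 2 * N s)%N -> measurable_fun setT (zetas s i))
  (hU : forall s, measurable_fun setT (U s))
  (hzetalaw : is_uniform P zeta (- sigma) sigma)
  (hzetaslaw : forall s i, (i < 2 * N s)%N -> is_uniform P (zetas s i) (- sigma) sigma)
  (hUlaw : forall s, is_uniform P (U s) 0 1)
  (hindep : mutually_independent P (rv_valid N)
              (rv_sigma X S Y Xs zeta zetas U)).

Local Notation pr A := (fine (P A)).
Local Notation G := (rv_sigma X S Y Xs zeta zetas U).

Definition rv_validb (j : rv_index K) : bool := `[< rv_valid N j >].

Lemma rv_sigma_setI_closed j : setI_closed (G j).
Proof.
case: j => [|s i||s i|s]; first exact: g_sigma_algebra_setI_closed.
all: apply: preimage_sigma_setI_closed.
exact: g_sigma_algebra_setI_closed.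
all: by move=> A B; exact: measurableI.
Qed.

Lemma rv_sigma_setT j : G j setT.
Proof.
case: j => [|s i||s i|s]; first exact: g_sigma_algebra_setT.
all: exists setT => //; exact: g_sigma_algebra_setT.
Qed.

Lemma rv_sigma_measurable j A : rv_validb j -> G j A -> measurable A.
Proof.
case: j => [|s i||s i|s] /asboolP/= v.
- move: A; apply: smallest_sub; first exact: sigma_algebra_measurable.
  move=> A [B1 [B2 [B3 [mB1 [mB3 ->]]]]].
  apply: measurableI; last by rewrite -[_ @^-1` _]setTI; exact: hY.
  apply: measurableI; first exact: hX.
  rewrite (_ : S @^-1` B2 = \bigcup_(s in B2) (S @^-1` [set s])).
    exact: fin_bigcup_measurable.
  by apply/seteqP; split => [x Bx|x [s Bs /= ->]//]; exists (S x).
- by case=> B mB <-; exact: hXs.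
- by case=> B mB <-; rewrite -[_ @^-1` _]setTI; exact: hzeta.
- by case=> B mB <-; rewrite -[_ @^-1` _]setTI; exact: hzetas.
- by case=> B mB <-; rewrite -[_ @^-1` _]setTI; exact: hU.
Qed.

Lemma rv_indep (J : seq (rv_index K)) (F : rv_index K -> set Omega) : uniq J ->
  (forall j, j \in J -> rv_validb j) -> (forall j, j \in J -> G j (F j)) ->
  pr (\bigcap_(j in [set` J]) F j) = \prod_(j <- J) pr (F j).
Proof.
move=> uJ vJ GF.
rewrite (_ : \bigcap_(j in [set` J]) F j = [set x | forall j, In j J -> F j x]).
  rewrite hindep; [|exact: uniq_NoDup|by move=> j /In_mem/vJ/asboolP|
    by move=> j /In_mem/GF].
  rewrite (eq_big_seq (fun j => (pr (F j))%:E)); first by rewrite prodEFin.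
  by move=> j jJ; apply: prE; apply: rv_sigma_measurable (vJ j jJ) (GF j jJ).
by apply/seteqP; split => x h j /In_mem; exact: h.
Qed.

(** The variables behind the [N s + 1] scores that are ranked against each other in group [s], test
    point included; [IU s] is kept apart as a block of its own. *)
Definition first_half (s : 'I_K) : seq (rv_index K) :=
  IMain K :: IZeta K :: [seq IXs s i | i <- iota 0 (N s)]
    ++ [seq IZetas s i | i <- iota 0 (N s)].

(** All groups are taken together, because the predictor averages the empirical quantile functions
    of every group. *)
Definition second_half : seq (rv_index K) :=
  [seq IXs s i | s <- enum 'I_K, i <- iota (N s) (N s)]
    ++ [seq IZetas s i | s <- enum 'I_K, i <- iota (N s) (N s)].

(* [Omega] with the sigma-algebra of the variables with indices in [J]. *)
Local Notation known J := (g_sigma_algebraType (cylinders G J)).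

Definition score (s : 'I_K) (x : Omega) : R := f (X x) s + zeta x.
Local Notation aux_score := (ftilde f Xs zetas).

Lemma measurable_fun_known (J : seq (rv_index K)) j (g : Omega -> R) : j \in J ->
  (forall B, measurable B -> G j (g @^-1` B)) ->
  measurable_fun setT (g : known J -> R).
Proof.
move=> jJ Gg _ B mB; rewrite setTI; apply: sub_sigma_algebra.
exact: (sub_cylinders rv_sigma_setT jJ (Gg _ mB)).
Qed.

(** [X] and [S] may be dependent, so the group event and the event on [X] must enter as one event of
    the index [IMain]. *)
Lemma IMain_event s (B : set R) : measurable B ->
  G (IMain K) (S @^-1` [set s] `&` (fun x => f (X x) s) @^-1` B).
Proof.
move=> mB; apply: sub_sigma_algebra.
exists ((fun x => f x s) @^-1` B), [set s], setT; split; first exact: hf.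
by split => //; rewrite preimage_setT setIT setIC.
Qed.

Lemma IMain_score s (B : set R) : measurable B ->
  G (IMain K) ((fun x => f (X x) s) @^-1` B).
Proof.
move=> mB; apply: sub_sigma_algebra.
exists ((fun x => f x s) @^-1` B), setT, setT; split; first exact: hf.
by split => //; rewrite !preimage_setT !setIT.
Qed.

Lemma IXs_score s i (B : set R) : measurable B ->
  G (IXs s i) ((fun x => f (Xs s i x) s) @^-1` B).
Proof. by move=> mB; exists ((fun x => f x s) @^-1` B) => //; exact: hf. Qed.

Lemma measurable_score (J : seq (rv_index K)) s : IMain K \in J -> IZeta K \in J ->
  measurable_fun setT (score s : known J -> R).
Proof.
move=> J1 J2; apply: measurable_funD.
  by apply: (measurable_fun_known J1) => B; exact: IMain_score.
by apply: (measurable_fun_known J2) => B mB; exists B.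
Qed.

Lemma measurable_aux_score (J : seq (rv_index K)) s i :
  IXs s i \in J -> IZetas s i \in J ->
  measurable_fun setT (aux_score s i : known J -> R).
Proof.
move=> J1 J2; apply: measurable_funD.
  by apply: (measurable_fun_known J1) => B; exact: IXs_score.
by apply: (measurable_fun_known J2) => B mB; exists B.
Qed.

Lemma known_measurable (J : seq (rv_index K)) A :
  (forall j, j \in J -> rv_validb j) -> <<s cylinders G J >> A -> measurable A.
Proof.
move=> vJ; move: A; apply: smallest_sub; first exact: sigma_algebra_measurable.
by move=> A; exact: (measurable_cylinders rv_sigma_measurable vJ).
Qed.

Lemma known_group (s : 'I_K) (J : seq (rv_index K)) : IMain K \in J ->
  <<s cylinders G J >> (S @^-1` [set s]).
Proof.
move=> jJ; apply: sub_sigma_algebra; apply: (sub_cylinders rv_sigma_setT jJ).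
by have := IMain_event s measurableT; rewrite preimage_setT setIT.
Qed.

Lemma group_gt0 (s : 'I_K) : 0 < pr (S @^-1` [set s]).
Proof. by apply: fine_gt0; rewrite hSpos -ge0_fin_numE// fin_num_measure. Qed.

(** On a rectangle for the pair (value of [f], noise), independence splits off the noise and the
    factors agree: [hXslaw] for the feature, the common uniform law for the noise. The Dynkin lemma
    passes from rectangles to the event that the sum lies in [B]. *)
Lemma score_law s i (B : set R) : (i < 2 * N s)%N -> measurable B ->
  pr (S @^-1` [set s] `&` score s @^-1` B) =
  pr (S @^-1` [set s]) * pr (aux_score s i @^-1` B).
Proof.
move=> iN mB.
pose g1 x := (f (X x) s, zeta x); pose g2 x := (f (Xs s i x) s, zetas s i x).
pose E := (fun x : R * R => x.1 + x.2) @^-1` B.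
have mE : measurable E.
  rewrite /E -[_ @^-1` _]setTI.
  by apply: (measurable_funD measurable_fst measurable_snd) => //; exact: measurableT.
pose rect := [set A `*` D | A in @measurable _ R & D in @measurable _ R].
have rE : <<s rect >> E by rewrite -measurable_prod_measurableType.
have [||||_ [A mA [D mD <-]]|_ _] := @g_sigma_algebra_pr_eq _ _ _ P _ rect g1 g2
    (S @^-1` [set s]) setT 1 (pr (S @^-1` [set s])) _ _ _ _ _ E rE.
- move=> _ _ [A mA [D mD <-]] [A' mA' [D' mD' <-]].
  exists (A `&` A'); first exact: measurableI.
  by exists (D `&` D'); [exact: measurableI|rewrite setXI].
- by exists setT => //; exists setT => //; rewrite setXTT.
- exact: hS.
- exact: measurableT.
- rewrite (_ : g1 @^-1` (A `*` D) = (fun x => f (X x) s) @^-1` A `&` zeta @^-1` D)//.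
  rewrite (_ : g2 @^-1` (A `*` D) =
    (fun x => f (Xs s i x) s) @^-1` A `&` zetas s i @^-1` D)// setTI.
  have v1 j : j \in [:: IMain K; IZeta K] -> rv_validb j.
    by rewrite !inE => /orP[] /eqP->; apply/asboolP.
  have v2 j : j \in [:: IXs s i; IZetas s i] -> rv_validb j.
    by rewrite !inE => /orP[] /eqP->; apply/asboolP.
  have u1 : uniq [:: IMain K; IZeta K] by rewrite /= inE andbT; apply/eqP.
  have u2 : uniq [:: IXs s i; IZetas s i] by rewrite /= inE andbT; apply/eqP.
  have h1 := IMain_event s mA.
  have h2 : G (IZeta K) (zeta @^-1` D) by exists D.
  have h3 := IXs_score s i mA.
  have h4 : G (IZetas s i) (zetas s i @^-1` D) by exists D.
  have c1 : pr (S @^-1` [set s] `&` (fun x => f (X x) s) @^-1` A `&` zeta @^-1` D)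
      = pr (S @^-1` [set s] `&` (fun x => f (X x) s) @^-1` A) * pr (zeta @^-1` D).
    apply: (cylinders_indep rv_indep (J := [:: IMain K]) (J' := [:: IZeta K])) => //.
      exact: (sub_cylinders rv_sigma_setT (mem_head _ _) h1).
    exact: (sub_cylinders rv_sigma_setT (mem_head _ _) h2).
  have c2 : pr ((fun x => f (Xs s i x) s) @^-1` A `&` zetas s i @^-1` D)
      = pr ((fun x => f (Xs s i x) s) @^-1` A) * pr (zetas s i @^-1` D).
    apply: (cylinders_indep rv_indep (J := [:: IXs s i]) (J' := [:: IZetas s i])) => //.
      exact: (sub_cylinders rv_sigma_setT (mem_head _ _) h3).
    exact: (sub_cylinders rv_sigma_setT (mem_head _ _) h4).
  have m1 : measurable (S @^-1` [set s] `&` (fun x => f (X x) s) @^-1` A).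
    by apply: (rv_sigma_measurable (j := IMain K)); rewrite ?v1 ?mem_head.
  have m2 : measurable (zeta @^-1` D).
    by apply: (rv_sigma_measurable (j := IZeta K)); rewrite ?v1 ?inE ?eqxx ?orbT.
  have m3 : measurable ((fun x => f (Xs s i x) s) @^-1` A).
    by apply: (rv_sigma_measurable (j := IXs s i)); rewrite ?v2 ?mem_head.
  have m4 : measurable (zetas s i @^-1` D).
    by apply: (rv_sigma_measurable (j := IZetas s i)); rewrite ?v2 ?inE ?eqxx ?orbT.
  split; [by rewrite setIA; exact: measurableI|exact: measurableI|].
  rewrite mul1r setIA c1 c2 (hzetalaw mD) (hzetaslaw iN mD).
  rewrite (hXslaw iN (hf s mA)) /condP mulrA; congr (_ * _).
  by rewrite mulrC divfK ?gt_eqF ?group_gt0// setIC.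
- by rewrite mul1r setTI.
Qed.

Lemma uniq_flatten_pairs (s : 'I_K) (r : seq nat) : uniq r ->
  uniq (flatten [seq [:: IXs s i; IZetas s i] | i <- r]).
Proof.
elim: r => //= i r IH /andP[ir /IH ->]; rewrite inE andbT negb_or -andbA.
apply/and3P; split; first exact/eqP.
all: apply: contra ir => /flattenP[_ /mapP[j jr ->]].
all: by rewrite !inE => /orP[] /eqP // [->].
Qed.

(* Index [0] is the test point; the others are the first half of the sample. *)
Definition scores s (k : 'I_(N s).+1) (x : Omega) : R :=
  if unlift ord0 k is Some i then aux_score s i x else score s x.

(** The scores live on disjoint blocks of two variables each, and [score_law] rewrites each
    auxiliary factor in terms of the test score. In the resulting product all indices [k] play the
    same role, which yields exchangeability. *)
Lemma scores_rectangle s (B : 'I_(N s).+1 -> set R) :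
  (forall k, measurable (B k)) ->
  let A := [set x | forall k, B k (scores k x)] in
  measurable (S @^-1` [set s] `&` A) /\
  pr (S @^-1` [set s] `&` A) = pr (S @^-1` [set s]) *
    \prod_k (pr (S @^-1` [set s] `&` score s @^-1` B k) / pr (S @^-1` [set s])).
Proof.
move=> mB A.
(* The block of the test point also carries the group event. *)
pose bs := ([:: IMain K; IZeta K], S @^-1` [set s] `&` score s @^-1` B ord0) ::
  [seq ([:: IXs s i; IZetas s i], aux_score s i @^-1` B (lift ord0 i))
     | i : 'I_(N s) <- enum 'I_(N s)].
have lt2N (i : 'I_(N s)) : (i < 2 * N s)%N by rewrite mul2n -addnn ltn_addl.
have E : \big[setI/setT]_(b <- bs) b.2 = S @^-1` [set s] `&` A.
  rewrite big_cons big_map/= -setIA; congr (_ `&` _).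
  rewrite -bigcap_seq; apply/seteqP; split => [x [B0 Bs] k|x h].
    rewrite /scores; case: unliftP => [i ->|-> //].
    by apply: Bs; rewrite /= mem_enum.
  split; first by have := h ord0; rewrite /scores unlift_none.
  by move=> i _; have := h (lift ord0 i); rewrite /scores liftK.
have Ebs : [seq b.1 | b <- bs] = [:: IMain K; IZeta K] ::
    [seq [:: IXs s i; IZetas s i] | i <- iota 0 (N s)].
  by rewrite /bs /= -val_enum_ord -!map_comp.
have [||||+ +] := blocks_indep rv_sigma_setI_closed rv_sigma_setT
  rv_sigma_measurable rv_indep (bs := bs) (J := [::]) (C := setT).
- rewrite cats0 Ebs /=.
  rewrite uniq_flatten_pairs ?iota_uniq// inE andbT negb_or -andbA.
  apply/and3P; split; first exact/eqP; last first.
    by apply/negP => /flattenP[_ /mapP[j _ ->]]; rewrite !inE => /orP[] /eqP.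
  by apply/negP => /flattenP[_ /mapP[j _ ->]]; rewrite !inE => /orP[] /eqP.
- move=> j; rewrite cats0 => /flattenP[_ /mapP[b + ->]].
  rewrite inE => /predU1P[->|/mapP[i _ ->]] /=.
    by rewrite !inE => /orP[] /eqP->; apply/asboolP.
  by rewrite !inE => /orP[] /eqP->; apply/asboolP; exact: lt2N.
- move=> b; rewrite inE => /predU1P[->|/mapP[i _ ->]] /=.
    apply: (@measurableI _ (known [:: IMain K; IZeta K])).
      exact: known_group (mem_head _ _).
    rewrite -[_ @^-1` _]setTI.
    by apply: measurable_score; rewrite ?inE ?eqxx ?orbT.
  rewrite -[_ @^-1` _]setTI.
  apply: (@measurable_aux_score [:: IXs s i; IZetas s i]);
    by rewrite ?inE ?eqxx ?orbT.
- exact: cylinders_setT rv_sigma_setT _.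
rewrite E setIT => mA ->; split => //.
rewrite pr_setT mulr1 big_cons big_map big_enum/= big_ord_recl mulrA; congr (_ * _).
  by rewrite mulrC divfK// gt_eqF ?group_gt0.
apply: eq_bigr => i _; rewrite (score_law (lt2N i))//.
by rewrite mulrC mulKf// gt_eqF ?group_gt0.
Qed.

(** * Law of the randomized rank *)

Definition score_vec s (x : Omega) : 'I_(N s).+1 -> R := fun k => scores k x.
Arguments score_vec : clear implicits.

Definition cmp_pr s (pi : {ffun 'I_(N s).+1 * 'I_(N s).+1 -> bool}) : R :=
  pr (S @^-1` [set s] `&` (@cmp_mx R _ \o score_vec s) @^-1` [set pi]).

(** On boxes, a permutation of the scores permutes the sides, which leaves the product of
    [scores_rectangle] unchanged. *)
Lemma score_vec_exchangeable s (t : {perm 'I_(N s).+1}) E :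
  <<s @rectangles R (N s).+1 >> E ->
  pr (S @^-1` [set s] `&` score_vec s @^-1` E) =
  pr (S @^-1` [set s] `&` (fun x => score_vec s x \o t) @^-1` E).
Proof.
move=> rE.
have [||||_ [B mB ->]|_ _] := @g_sigma_algebra_pr_eq _ _ _ P _ _ (score_vec s)
  (fun x => score_vec s x \o t) (S @^-1` [set s]) (S @^-1` [set s]) 1 1
  _ _ _ _ _ E rE.
- exact: rectangles_setI_closed.
- exact: rectangles_setT.
- exact: hS.
- exact: hS.
- have tE : (fun x => score_vec s x \o t) @^-1` [set z | forall k, B k (z k)] =
      [set x | forall k, B ((t^-1)%g k) (scores k x)].
    apply/seteqP; split => x h k.
      by have := h ((t^-1)%g k); rewrite /= permKV.
    by have := h (t k); rewrite permK.
  rewrite tE.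
  have [mA ->] := @scores_rectangle s B mB.
  have [mA' ->] := @scores_rectangle s (fun k => B ((t^-1)%g k)) (fun k => mB _).
  split => //; congr (_ * (_ * _)).
  by rewrite [RHS](reindex_inj (@perm_inj _ t)); apply: eq_bigr => k _; rewrite permK.
- by rewrite !mul1r.
Qed.

Lemma cmp_pr_perm s (i j : 'I_(N s).+1) pi :
  cmp_pr (perm_cmp_mx (tperm i j) pi) = cmp_pr pi.
Proof.
rewrite /cmp_pr [RHS](score_vec_exchangeable (tperm i j) (@cmp_mx_event R _ pi)).
congr (pr (_ `&` _)); apply/seteqP; split => x /=; rewrite cmp_mx_perm => h.
  by rewrite h perm_cmp_mxK.
by rewrite -h perm_cmp_mxK.
Qed.

Lemma measurable_cmp s pi : measurable
  (S @^-1` [set s] `&` (@cmp_mx R _ \o score_vec s) @^-1` [set pi]).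
Proof.
(* Both sides are the same here: the Dynkin lemma serves only for its measurability conclusion. *)
have [||||_ [B mB ->]|? _ _] := @g_sigma_algebra_pr_eq _ _ _ P _ _ (score_vec s)
  (score_vec s) (S @^-1` [set s]) (S @^-1` [set s]) 1 1
  _ _ _ _ _ _ (@cmp_mx_event R _ pi) => //.
- exact: rectangles_setI_closed.
- exact: rectangles_setT.
- by have [mA _] := @scores_rectangle s B mB.
Qed.

Lemma sum_cmp_pr s : \sum_pi @cmp_pr s pi = pr (S @^-1` [set s]).
Proof.
by have [_ ->] := pr_sum_fin P (@measurable_cmp s).
Qed.

Local Notation clamp c x := (Num.max 0 (Num.min c x)).

(** The left side, times [N s + 1], is a sum of equal terms; exchangeability turns the [i]-th into
    the one where point [i] is ranked, and for each matrix [sum_randomized_rank] evaluates the sum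
    over [i]. *)
Lemma sum_cmp_pr_rank s (c : R) :
  \sum_pi @cmp_pr s pi * clamp ((c - (n_below pi ord0)%:R) / (n_tied pi ord0)%:R) 1
  = pr (S @^-1` [set s]) * clamp c (N s).+1%:R / (N s).+1%:R.
Proof.
pose h pi (i : 'I_(N s).+1) : R :=
  clamp ((c - (n_below pi i)%:R) / (n_tied pi i)%:R) 1.
(* Reindexing by the transposition of [ord0] and [i] preserves [cmp_pr] and moves the ranked point
   to [i]. *)
have step i : \sum_pi cmp_pr pi * h pi ord0 = \sum_pi cmp_pr pi * h pi i.
  rewrite (reindex_inj (inv_inj (@perm_cmp_mxK _ ord0 i))).
  by apply: eq_bigr => pi _; rewrite cmp_pr_perm /h n_below_perm n_tied_perm tpermL.
apply: (@mulIf _ (N s).+1%:R); first by rewrite pnatr_eq0.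
rewrite divfK ?pnatr_eq0// mulr_natr.
have -> (y : R) : y *+ (N s).+1 = \sum_(i < (N s).+1) y by rewrite sumr_const card_ord.
rewrite (eq_bigr _ (fun i _ => step i)) exchange_big/= -sum_cmp_pr mulr_suml.
apply: eq_bigr => pi _; rewrite -mulr_sumr.
(* A matrix that no vector of reals realizes has probability 0; for the others [sum_randomized_rank]
   applies. *)
have [[z <-]|npi] := pselect (exists z : 'I_(N s).+1 -> R, cmp_mx z = pi).
  under [X in _ * X]eq_bigr => i _ do rewrite /h n_below_cmp_mx n_tied_cmp_mx.
  by rewrite (@sum_randomized_rank _ _ z c predT)// cardT size_enum_ord.
rewrite {1 2}/cmp_pr (_ : _ `&` _ = set0) ?measure0 ?mul0r//.
by apply/seteqP; split => // x [_ /= e]; apply: npi; exists (score_vec s x).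
Qed.

(** * Independence of the ranked scores, the randomization and the second halves *)

Lemma second_halfP j : j \in second_half ->
  exists s i, (N s <= i < 2 * N s)%N /\ (j = IXs s i \/ j = IZetas s i).
Proof.
rewrite mem_cat => /orP[] /allpairsPdep[s [i [_ + ->]]];
  rewrite mem_iota addnn -mul2n => ?; exists s, i; split => //; by [left|right].
Qed.

Lemma mem_second_half s i : (N s <= i < 2 * N s)%N ->
  (IXs s i \in second_half) && (IZetas s i \in second_half).
Proof.
move=> iN; rewrite !mem_cat; apply/andP; split; apply/orP; [left|right];
  by apply/allpairsPdep; exists s, i; rewrite mem_enum mem_iota addnn -mul2n.
Qed.

Lemma first_halfP s j : j \in first_half s ->
  [\/ j = IMain K, j = IZeta K |
      exists2 i, (i < N s)%N & j = IXs s i \/ j = IZetas s i].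
Proof.
rewrite !inE mem_cat => /orP[/eqP->|/orP[/eqP->|/orP[] /mapP[i + ->]]].
- exact: Or31.
- exact: Or32.
- by rewrite mem_iota => ?; apply: Or33; exists i => //; left.
- by rewrite mem_iota => ?; apply: Or33; exists i => //; right.
Qed.

Lemma mem_first_half s i : (i < N s)%N ->
  (IXs s i \in first_half s) && (IZetas s i \in first_half s).
Proof.
move=> iN; rewrite !inE !mem_cat /=; apply/andP; split;
  by rewrite map_f ?mem_iota ?orbT.
Qed.

Lemma uniq_halves s : uniq (first_half s ++ [:: IU s] ++ second_half).
Proof.
have injX s' : injective (@IXs K s') by move=> i j [].
have injZ s' : injective (@IZetas K s') by move=> i j [].
rewrite !cat_uniq; apply/and5P; split => //.
- rewrite /= inE !mem_cat negb_or -!andbA; apply/and4P; split.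
  + exact/eqP.
  + by apply/norP; split; apply/mapP => -[].
  + by apply/norP; split; apply/mapP => -[].
  rewrite cat_uniq !map_inj_uniq ?iota_uniq//= andbT.
  by apply/hasPn => _ /mapP[i _ ->]; apply/mapP => -[].
- apply/hasPn => j; rewrite inE => jB; apply/negP => /first_halfP jA.
  move: jB => /predU1P[jU|/second_halfP[s' [i [/andP[iN _] jB]]]].
    by case: jA => [||[i _ []]]; rewrite jU.
  case: jA => [||[k kN]]; [by case: jB => ->|by case: jB => ->|].
  (* A common index would be both below [N s] and at least [N s]. *)
  by case: jB => -> [] // [es ei]; move: kN; rewrite -ei -es ltnNge iN.
- by apply/hasPn => j /second_halfP[s' [i [_ jB]]]; rewrite inE;
    apply/eqP; case: jB => ->.
- apply/and3P; split.
  + apply: allpairs_uniq_dep; [exact: enum_uniq|by move=> *; exact: iota_uniq|].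
    by move=> [s1 i1] [s2 i2] _ _ /= [-> ->].
  + apply/hasPn => _ /allpairsPdep[s1 [i1 [_ _ ->]]].
    by apply/allpairsPdep => -[s2 [i2 [_ _]]].
  + apply: allpairs_uniq_dep; [exact: enum_uniq|by move=> *; exact: iota_uniq|].
    by move=> [s1 i1] [s2 i2] _ _ /= [-> ->].
Qed.

Lemma halves_valid s j : j \in first_half s ++ [:: IU s] ++ second_half ->
  rv_validb j.
Proof.
rewrite mem_cat => /orP[/first_halfP jA|]; last rewrite mem_cat inE => /orP[/eqP->|].
- apply/asboolP; case: jA => [->|->|[i iN [->|->]]] //=;
    by rewrite mul2n -addnn ltn_addl.
- exact/asboolP.
- by move=> /second_halfP[s' [i [/andP[_ iN] [->|->]]]]; apply/asboolP.
Qed.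

Lemma halves_indep s A B C :
  <<s cylinders G (first_half s) >> A -> G (IU s) B ->
  <<s cylinders G second_half >> C ->
  [/\ measurable A, measurable B, measurable C &
      pr (A `&` (B `&` C)) = pr A * (pr B * pr C)].
Proof.
move=> cA gB cC.
have cB : <<s cylinders G [:: IU s] >> B.
  by apply: sub_sigma_algebra; exact: (sub_cylinders rv_sigma_setT (mem_head _ _)).
have v := @halves_valid s.
split.
- by apply: known_measurable cA => j jA; apply: v; rewrite mem_cat jA.
- by apply: known_measurable cB => j jA; apply: v; rewrite !mem_cat jA !orbT.
- by apply: known_measurable cC => j jA; apply: v; rewrite mem_cat (mem_cat _ [:: IU s]) jA !orbT.
have [||||_] := blocks_indep rv_sigma_setI_closed rv_sigma_setT
  rv_sigma_measurable rv_indep (J := [::]) (C := setT)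
  (bs := [:: (first_half s, A); ([:: IU s], B); (second_half, C)]).
- by rewrite /= !cats0 -[_ :: second_half]/([:: IU s] ++ second_half); exact: uniq_halves.
- by rewrite /= !cats0 -[_ :: second_half]/([:: IU s] ++ second_half).
- by move=> b; rewrite !inE => /or3P[] /eqP->.
- exact: cylinders_setT rv_sigma_setT _.
by rewrite !big_cons !big_nil/= !setIT pr_setT !mulr1.
Qed.

Lemma measurable_scores s k :
  measurable_fun setT (@scores s k : known (first_half s) -> R).
Proof.
rewrite /scores; case: unliftP => [i _|_].
  by apply: measurable_aux_score; have /andP[] := @mem_first_half s i (ltn_ord i).
by apply: measurable_score; rewrite !inE eqxx ?orbT.
Qed.

Lemma cmp_event_known s pi : <<s cylinders G (first_half s) >>
  (S @^-1` [set s] `&` (@cmp_mx R _ \o score_vec s) @^-1` [set pi]).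
Proof.
apply: (@measurableI _ (known (first_half s))).
  by apply: known_group; rewrite !inE eqxx.
rewrite (_ : _ @^-1` _ = \bigcap_(ij in setT) ((fun x : known (first_half s) =>
    scores ij.1 x < scores ij.2 x) @^-1` [set pi ij])).
  apply: (@fin_bigcap_measurable _ (known (first_half s))) => // ij _.
  rewrite -[X in measurable X]setTI.
  by apply: measurable_fun_ltr => //; exact: measurable_scores.
apply/seteqP; split => [x /= <- ij _|x h /=]; first by rewrite /= ffunE.
by apply/ffunP => ij; rewrite ffunE; exact: (h ij).
Qed.

(** The clamp covers every real [u]; the thresholds that occur later may fall outside [0, 1]. *)
Lemma U_cdf s (u : R) : pr (U s @^-1` [set` `]-oo, u]]) = clamp u 1.
Proof.
rewrite hUlaw// subr0 invr1 mule1.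
have [u0|u0] := ltP u 0.
  rewrite (_ : _ `&` _ = set0) ?measure0/=.
    by rewrite /Num.max /Num.min; repeat case: ifPn; rewrite -?leNgt => *; lra.
  by apply/seteqP; split => // y [] /=; rewrite !in_itv/= => yu /andP[y0 _]; lra.
have -> : [set` `]-oo, u]] `&` [set` `[0, 1]] = [set` `[0, Num.min u 1]] :> set R.
  apply/seteqP; split => [y []|y] /=; rewrite !in_itv/= le_min.
    by move=> -> /andP[-> ->].
  by move=> /andP[-> /andP[-> ->]].
rewrite lebesgue_measure_itv/= lte_fin.
by case: ltP => m0; rewrite /= ?oppr0 ?addr0.
Qed.

Definition rand_rank s (x : Omega) : R := F1hat f N Xs zetas U s (score s x) x.

(** The rank is affine in [U s x] with positive slope, so the inequality can be solved for [U s x].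
    The summand 1 in [F1hat] is the tie of the test point with itself. *)
Lemma rand_rank_le s x v : (rand_rank s x <= v) =
  (U s x <= ((N s).+1%:R * v - (n_below (cmp_mx (score_vec s x)) ord0)%:R)
              / (n_tied (cmp_mx (score_vec s x)) ord0)%:R).
Proof.
have B : (n_below (cmp_mx (score_vec s x)) ord0)%:R =
    \sum_(0 <= i < N s) (((aux_score s i x < score s x)%R)%:R : R).
  rewrite n_below_cmp_mx -sum1_card big_mkcond big_ord_recl big_mkord natrD natr_sum.
  rewrite !inE ltxx add0r; apply: eq_bigr => i _.
  by rewrite !inE /score_vec /scores liftK unlift_none; case: ifP.
have T : (n_tied (cmp_mx (score_vec s x)) ord0)%:R =
    1 + \sum_(0 <= i < N s) (((aux_score s i x == score s x)%R)%:R : R).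
  rewrite n_tied_cmp_mx -sum1_card big_mkcond big_ord_recl big_mkord natrD natr_sum.
  rewrite !inE eqxx; congr (_ + _); apply: eq_bigr => i _.
  by rewrite !inE /score_vec /scores liftK unlift_none; case: ifP.
have T0 : 0 < (n_tied (cmp_mx (score_vec s x)) ord0)%:R :> R.
  by rewrite ltr0n n_tied_gt0.
rewrite /rand_rank /F1hat -B -T ler_pdivlMr// lerBrDl ler_pdivrMl//.
Qed.

(** On each comparison matrix the rank event is a threshold on [U s], independent of the matrix and
    of [C]. The pieces are summed by [sum_cmp_pr_rank] with [c] equal to [(N s).+1%:R * v], and the
    final division by [N s + 1] rescales the clamp. *)
Lemma rand_rank_law s v C : <<s cylinders G second_half >> C ->
  measurable (S @^-1` [set s] `&` ([set x | rand_rank s x <= v] `&` C)) /\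
  pr (S @^-1` [set s] `&` ([set x | rand_rank s x <= v] `&` C)) =
  pr (S @^-1` [set s]) * clamp v 1 * pr C.
Proof.
move=> cC.
pose thr (pi : {ffun 'I_(N s).+1 * 'I_(N s).+1 -> bool}) : R := ((N s).+1%:R * v - (n_below pi ord0)%:R) / (n_tied pi ord0)%:R.
set B := _ `&` _; pose g := @cmp_mx R _ \o score_vec s.
have E pi : B `&` g @^-1` [set pi] = (S @^-1` [set s] `&` g @^-1` [set pi]) `&`
    (U s @^-1` [set` `]-oo, thr pi]] `&` C).
  rewrite /B; apply/seteqP; split => [x [] [Sx] [/= rx Cx] gx|x [] [Sx gx] [/= Ux Cx]].
    by split => //; split => //=; rewrite in_itv/= /thr -gx -rand_rank_le.
  split => //; split => //; split => //=; move: Ux.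
  by rewrite in_itv/= /thr -gx -rand_rank_le.
have piece pi : measurable (B `&` g @^-1` [set pi]) /\
    pr (B `&` g @^-1` [set pi]) = cmp_pr pi * (clamp (thr pi) 1 * pr C).
  have [|m1 m2 m3 e] := halves_indep (cmp_event_known pi)
    (_ : G (IU s) (U s @^-1` [set` `]-oo, thr pi]])) cC.
    by exists [set` `]-oo, thr pi]].
  rewrite E e U_cdf; split => //.
  by apply: measurableI => //; exact: measurableI.
have [mB ->] := pr_sum_fin P (fun pi => (piece pi).1).
split => //; under eq_bigr => pi _ do rewrite (piece pi).2 mulrA.
rewrite -mulr_suml sum_cmp_pr_rank; congr (_ * _); rewrite -mulrA; congr (_ * _).
have N0 : 0 < (N s).+1%:R :> R by rewrite ltr0n.
rewrite mulrC maxr_pMr ?invr_ge0 ?ltW// minr_pMr ?invr_ge0 ?ltW//.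
by rewrite mulr0 mulKf ?gt_eqF// mulVf ?gt_eqF.
Qed.

Lemma rand_rank_lawT s C : <<s cylinders G second_half >> C ->
  measurable (S @^-1` [set s] `&` C) /\
  pr (S @^-1` [set s] `&` C) = pr (S @^-1` [set s]) * pr C.
Proof.
move=> cC.
have cS : <<s cylinders G (first_half s) >> (S @^-1` [set s]).
  by apply: known_group; rewrite !inE eqxx.
have [mS _ mC] := halves_indep cS (rv_sigma_setT (IU s)) cC.
by rewrite setTI pr_setT mul1r; split => //; exact: measurableI.
Qed.

(** * The predictor as a function of the rank and the second halves *)

(** The second component is the whole outcome, but it carries only the sigma-algebra of the second
    halves. Measurability for the generated sigma-algebra thus encodes dependence on the rank and
    the second halves alone. *)
Definition rank_boxes : set (set (R * Omega)) :=
  [set E | exists2 C, <<s cylinders G second_half >> C &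
    E = setT `*` C \/ exists v, E = [set` `]-oo, v]] `*` C].

Local Notation rank_space := (g_sigma_algebraType rank_boxes).

Lemma rank_boxes_setI_closed : setI_closed rank_boxes.
Proof.
have CI := @measurableI _ (known second_half).
move=> _ _ [C cC [->|[v ->]]] [C' cC' [->|[v' ->]]]; rewrite -setXI;
  exists (C `&` C'); try exact: CI.
- by left; rewrite setTI.
- by right; exists v'; rewrite setTI.
- by right; exists v; rewrite setIT.
- right; exists (Num.min v v'); congr (_ `*` _).
  by apply/seteqP; split => x /=; rewrite !in_itv/= le_min => /andP.
Qed.

Lemma rank_boxes_setT : rank_boxes setT.
Proof.
by exists setT; [exact: (@measurableT _ (known second_half))|left; rewrite setXTT].
Qed.

Lemma measurable_rank_fst : measurable_fun setT (fst : rank_space -> R).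
Proof.
apply: (measurability _ (RGenOInfty.measurableE R)) => //.
move=> _ [_ [v ->] <-]; rewrite setTI -setCitvl preimage_setC.
apply: (@measurableC _ rank_space); apply: sub_sigma_algebra.
exists setT; first exact: (@measurableT _ (known second_half)).
by right; exists v; rewrite setXT.
Qed.

Lemma measurable_rank_snd (g : Omega -> R) :
  measurable_fun setT (g : known second_half -> R) ->
  measurable_fun setT (fun z : rank_space => g z.2).
Proof.
move=> mg _ B mB; rewrite setTI; apply: sub_sigma_algebra.
exists (g @^-1` B); first by rewrite -[_ @^-1` _]setTI; exact: mg.
by left; rewrite setTX.
Qed.

Local Notation F2 := (F2hat f N Xs zetas).

Lemma F2hatE s q x : F2 s q x =
  (N s)%:R^-1 * \sum_(i < N s) (((aux_score s (i + N s) x <= q)%R)%:R : R).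
Proof.
rewrite /F2hat; congr (_ * _).
by rewrite -{1}[N s]add0n big_addn mul2n -addnn addnK big_mkord.
Qed.

Lemma measurable_F2hat s q :
  measurable_fun setT (fun z : rank_space => F2 s q z.2).
Proof.
under eq_fun do rewrite F2hatE.
apply: measurable_funM; first exact: measurable_cst.
apply: measurable_sum => i.
have mi : measurable_fun setT (fun z : rank_space => aux_score s (i + N s) z.2).
  apply: measurable_rank_snd; have iN : (N s <= i + N s < 2 * N s)%N.
    by rewrite leq_addl mul2n -addnn ltn_add2r ltn_ord.
  by apply: measurable_aux_score; have /andP[] := mem_second_half iN.
rewrite (_ : (fun _ => _) =
    \1_((fun z : rank_space => aux_score s (i + N s) z.2) @^-1` [set` `]-oo, q]])).
  apply: measurable_indic; rewrite -[X in measurable X]setTI.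
  by apply: mi => //; exact: measurable_itv.
apply/funext => z; rewrite indicE; set b := z \in _.
suff -> : b = (aux_score s (i + N s) z.2 <= q) by [].
by rewrite /b; apply/idP/idP => [/set_mem|h]; [|apply/mem_set]; rewrite /= in_itv.
Qed.

Lemma F2hat_itv s q x : 0 <= F2 s q x <= 1.
Proof.
rewrite F2hatE mulr_ge0 ?invr_ge0// ?sumr_ge0//=.
rewrite ler_pdivrMl ?ltr0n// mulr1 -[X in _ <= X%:R](card_ord (N s)) -sumr_const.
by apply: ler_sum => i _; rewrite lern1 leq_b1.
Qed.

Lemma F2hat_nondecreasing s x : {homo F2 s ^~ x : q q' / q <= q'}.
Proof.
move=> q q' qq'; rewrite !F2hatE ler_wpM2l ?invr_ge0//.
apply: ler_sum => i _; rewrite ler_nat.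
by case: (leP _ q) => // iq; rewrite (le_trans iq qq').
Qed.

Lemma F2hat1 s x : exists q, F2 s q x = 1.
Proof.
(* The sum of absolute values bounds all scores of the second half at once. *)
exists (\sum_(i < N s) `|aux_score s (i + N s) x|); rewrite F2hatE.
rewrite (eq_bigr (fun=> 1)) => [|i _].
  by rewrite sumr_const card_ord mulVf// pnatr_eq0 -lt0n.
suff -> : aux_score s (i + N s) x <= \sum_(i < N s) `|aux_score s (i + N s) x| by [].
by apply: le_trans (ler_norm _) _; rewrite (bigD1 i)//= lerDl sumr_ge0.
Qed.

Lemma F2hat0 s x : exists l, forall q, q < l -> F2 s q x = 0.
Proof.
exists (- \sum_(i < N s) `|aux_score s (i + N s) x|) => q ql; rewrite F2hatE.
rewrite big1 ?mulr0// => i _; suff qi : q < aux_score s (i + N s) x by rewrite leNgt qi.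
apply: (lt_le_trans ql); rewrite lerNl; apply: le_trans (ler_norm _) _.
by rewrite normrN (bigD1 i)//= lerDl sumr_ge0.
Qed.

(** The group of the test point does not occur: it enters only through the rank supplied as
    [z.1]. *)
Definition transport (z : R * Omega) : R :=
  \sum_(s < K) w s * F2hat_inv f N Xs zetas s z.1 z.2.

Lemma measurable_transport : measurable_fun setT (transport : rank_space -> R).
Proof.
apply: measurable_sum => s; apply: measurable_funM; first exact: measurable_cst.
apply: (measurable_generalized_inverse (F := fun q (z : rank_space) => F2 s q z.2)).
- exact: measurable_F2hat.
- exact: measurable_rank_fst.
- by move=> z; exact: F2hat_nondecreasing.
- by move=> q z; exact: F2hat_itv.
- by move=> z; exact: F2hat1.
- by move=> z; exact: F2hat0.
Qed.

(** This is equality of the conditional laws of rank and second halves, cross-multiplied. On a box,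
    each probability is that of the group times a factor free of the group, by [rand_rank_law] or
    [rand_rank_lawT]. *)
Lemma rank_boxes_law s s' E : <<s rank_boxes >> E ->
  pr (S @^-1` [set s']) * pr (S @^-1` [set s] `&` (fun x => (rand_rank s x, x)) @^-1` E)
  = pr (S @^-1` [set s])
    * pr (S @^-1` [set s'] `&` (fun x => (rand_rank s' x, x)) @^-1` E).
Proof.
move=> bE.
have [||||_ [C cC [->|[v ->]]]|_ _ //] := @g_sigma_algebra_pr_eq _ _ _ P _ rank_boxes
  (fun x => (rand_rank s x, x)) (fun x => (rand_rank s' x, x))
  (S @^-1` [set s]) (S @^-1` [set s']) (pr (S @^-1` [set s'])) (pr (S @^-1` [set s]))
  _ _ _ _ _ E bE.
- exact: rank_boxes_setI_closed.
- exact: rank_boxes_setT.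
- exact: hS.
- exact: hS.
- have boxE s0 : (fun x => (rand_rank s0 x, x)) @^-1` (setT `*` C) = C.
    by apply/seteqP; split => [x []|x].
  rewrite !boxE; have [m e] := rand_rank_lawT s cC; have [m' e'] := rand_rank_lawT s' cC.
  by split => //; rewrite e e' mulrCA.
- have boxE s0 : (fun x => (rand_rank s0 x, x)) @^-1` ([set` `]-oo, v]] `*` C) =
      [set x | rand_rank s0 x <= v] `&` C.
    by apply/seteqP; split => x [] /=; rewrite in_itv.
  rewrite !boxE; have [m e] := rand_rank_law s v cC; have [m' e'] := rand_rank_law s' v cC.
  by split => //; rewrite e e' -!mulrA mulrCA.
Qed.

Lemma Pihat_parity s s' (B : set R) : measurable B ->
  condP P (Pihat f w N X S Xs zeta zetas U @^-1` B) (S @^-1` [set s]) =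
  condP P (Pihat f w N X S Xs zeta zetas U @^-1` B) (S @^-1` [set s']).
Proof.
move=> mB; rewrite /condP.
have bE : <<s rank_boxes >> (transport @^-1` B).
  by rewrite -[_ @^-1` _]setTI; exact: measurable_transport.
(* On the event that [S] is [s0], the argument of the quantile functions in [Pihat] is
   [rand_rank s0], so [Pihat] coincides with [transport] there. *)
have E s0 : Pihat f w N X S Xs zeta zetas U @^-1` B `&` S @^-1` [set s0] =
    S @^-1` [set s0] `&` (fun x => (rand_rank s0 x, x)) @^-1` (transport @^-1` B).
  rewrite setIC; apply/seteqP; split => x [] /= Sx; rewrite /Pihat Sx; split => //.
have n0 s0 : pr (S @^-1` [set s0]) != 0 by rewrite gt_eqF// group_gt0.
apply/eqP; rewrite !E eqr_div//; apply/eqP.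
by rewrite mulrC [RHS]mulrC; exact: rank_boxes_law.
Qed.

End data.

Theorem theorem5 (R : realType) (d : measure_display) (Omega : measurableType d)
  (P : probability Omega R) (p K : nat)
  (* the predictor f : R^p x [K] -> R, measurable *)
  (f : 'rV[R]_p -> 'I_K -> R) (hf : meas_feature_fun f)
  (* weights w in the simplex *)
  (w : 'I_K -> R) (hw0 : forall s, 0 <= w s) (hw1 : \sum_(s < K) w s = 1)
  (* noise level and sample sizes *)
  (sigma : R) (hsigma : 0 < sigma)
  (N : 'I_K -> nat) (hN : forall s, (0 < N s)%N)
  (* the data (X, S, Y) *)
  (X : Omega -> 'rV[R]_p) (S : Omega -> 'I_K) (Y : Omega -> R)
  (hX : forall B, @Rp_sigma R p B -> measurable (X @^-1` B))
  (hS : forall s, measurable (S @^-1` [set s]))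
  (hY : measurable_fun setT Y)
  (hSpos : forall s, (0 < P (S @^-1` [set s]))%E)
  (* the auxiliary unlabeled samples X^s_i, i < 2 N_s, from Law(X | S = s) *)
  (Xs : 'I_K -> nat -> Omega -> 'rV[R]_p)
  (hXs : forall s i B, (i < 2 * N s)%N -> @Rp_sigma R p B ->
          measurable (Xs s i @^-1` B))
  (hXslaw : forall s i B, (i < 2 * N s)%N -> @Rp_sigma R p B ->
          fine (P (Xs s i @^-1` B)) = condP P (X @^-1` B) (S @^-1` [set s]))
  (* the noises zeta, zeta^s_i uniform on [-sigma, sigma], U^s uniform on [0,1] *)
  (zeta : Omega -> R) (zetas : 'I_K -> nat -> Omega -> R) (U : 'I_K -> Omega -> R)
  (hzeta : measurable_fun setT zeta)
  (hzetas : forall s i, (i < 2 * N s)%N -> measurable_fun setT (zetas s i))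
  (hU : forall s, measurable_fun setT (U s))
  (hzetalaw : is_uniform P zeta (- sigma) sigma)
  (hzetaslaw : forall s i, (i < 2 * N s)%N -> is_uniform P (zetas s i) (- sigma) sigma)
  (hUlaw : forall s, is_uniform P (U s) 0 1)
  (* mutual independence of (X,S,Y), the X^s_i, zeta, the zeta^s_i and the U^s *)
  (hindep : mutually_independent P (rv_valid N)
              (rv_sigma X S Y Xs zeta zetas U)) :
  forall (s s' : 'I_K) (B : set R), measurable B ->
    condP P (Pihat f w N X S Xs zeta zetas U @^-1` B) (S @^-1` [set s]) =
    condP P (Pihat f w N X S Xs zeta zetas U @^-1` B) (S @^-1` [set s']).
Proof.
move=> s s' B; exact: (Pihat_parity hf w hN hX hS hY hSpos hXs hXslaw hzeta
  hzetas hU hzetalaw hzetaslaw hUlaw hindep).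
Qed.
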